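(* Let $(G,+)$ be a countable abelian group and let $A\subseteq G$. Then for any Følner sequence $F=(F_N)_{N\in\mathbb{N}}$ in $G$ there is some $B\subseteq G$ such that $\overline{d}_F(B)\geq d^*(A)^2$ and $B+B\subseteq A-A$.
   Context: ''Countable'' means in bijective correspondence with $\mathbb{N}$. A Følner sequence in a countable abelian group $G$ is a sequence $(F_N)_{N\in\mathbb{N}}$ of finite nonempty subsets of $G$ such that $\lim_{N\to\infty}\frac{|(g+F_N)\Delta F_N|}{|F_N|}=0$ for all $g\in G$. For $E\subseteq G$, $\overline{d}_F(E)=\limsup_{N\to\infty}\frac{|E\cap F_N|}{|F_N|}$, and the upper Banach density is $d^*(E)=\sup\{\overline{d}_F(E):F\text{ a Følner sequence in }G\}$. $B+B=\{b+b':b,b'\in B\}$ and $A-A=\{a-a':a,a'\in A\}$. *)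

(* Defs.v *)
From HB Require Import structures.
From mathcomp Require Import all_boot all_order all_algebra finmap.
From mathcomp Require Import all_classical all_reals all_analysis.

Set Implicit Arguments.
Unset Strict Implicit.
Unset Printing Implicit Defensive.

Import Order.TTheory GRing.Theory Num.Theory.
Import numFieldNormedType.Exports.

Local Open Scope classical_set_scope.
Local Open Scope ring_scope.

Definition translate (G : zmodType) (g : G) (E : {fset G}) : {fset G} :=
  [fset (g + x)%R | x in E]%fset.

Definition fsymdiff (T : choiceType) (E E' : {fset T}) : {fset T} :=
  ((E `\` E') `|` (E' `\` E))%fset.

Definition folner_sequence (R : realType) (G : zmodType)
    (F : nat -> {fset G}) : Prop :=
  (forall N, F N != fset0) /\
  (forall g : G,
     (fun N => (#|` fsymdiff (translate g (F N)) (F N)|%:R : R)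
               / #|` F N|%:R) @ \oo --> (0 : R)).

(* The densities live in \bar R, where limsup and sup need no side conditions. *)
Definition upper_density (R : realType) (G : zmodType)
    (F : nat -> {fset G}) (E : set G) : \bar R :=
  limn_esup (fun N =>
    ((#|` [fset x in F N | x \in E]%fset|%:R : R) / #|` F N|%:R)%:E).

Definition upper_banach_density (R : realType) (G : zmodType) (E : set G)
    : \bar R :=
  ereal_sup [set upper_density R F E | F in [set F | folner_sequence R F]].

Definition sumset (G : zmodType) (A B : set G) : set G :=
  [set a + b | a in A & b in B].

Definition diffset (G : zmodType) (A B : set G) : set G :=
  [set a - b | a in A & b in B].

(* Main.v *)
Require Import Defs.
From HB Require Import structures.
From mathcomp Require Import all_boot all_order all_algebra finmap.
From mathcomp Require Import all_classical all_reals all_analysis.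
From mathcomp Require Import lra ring.

Set Implicit Arguments.
Unset Strict Implicit.
Unset Printing Implicit Defensive.

Import Order.TTheory GRing.Theory Num.Theory.
Import numFieldNormedType.Exports.

Local Open Scope classical_set_scope.
Local Open Scope ring_scope.

(** For t in G put B(t) = {b | b + t in A and - b + t in A}. If b and b' both lie
in B(t), then b + b' = (b + t) - (- b' + t) lies in A - A, so every B(t) has the
required algebraic property, and so does any B each pair of whose elements lies
in a common B(t). In particular, for an ultrafilter W on G, one may take
B = {b | W-almost every t has b in B(t)}; inside a finite set such a B coincides
with B(t) for W-almost every t (ultrafilter_decides). It remains to find W
making B dense along F.

Densities of B(t) are averaged over t with a finitely additive
translation-invariant mean m on G such that m(1_A) >= d*(A)
(invariant_mean_exists); write g |-> c(g) for m(1_A . 1_(A - g)). If f_N(t) is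
the density of B(t) in F_N, then m(f_N) is the average over b in F_N of c(2b).
As c is positive definite, with Gram sums bounded below through the
Cauchy-Schwarz inequality, this average is eventually at least m(1_A)^2 - e, for
every e > 0 (positive_definite_average). This replaces the mean ergodic theorem.

For a countably additive m, the reverse Fatou lemma would now give some t with
limsup f_N(t) >= m(1_A)^2. A finitely additive mean need not give such a
point t, but it gives an ultrafilter W of points for which, for every e > 0 and
infinitely many N, W-almost all t satisfy f_N(t) >= m(1_A)^2 - e
(ultrafilter_large_values). The corresponding B then has upper density at least
m(1_A)^2 along F. *)

(** * Finitely additive means *)

Section Mean.
Context {R : realType}.

Definition bounded_range (T : Type) (f : T -> R) : Prop :=
  exists M, forall x, `|f x| <= M.

Lemma bounded_range_le (T : Type) (f g : T -> R) :
  bounded_range g -> (forall x, `|f x| <= `|g x|) -> bounded_range f.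
Proof. by move=> [M gM] fg; exists M => x; exact: le_trans (gM x). Qed.

Lemma bounded_cst (T : Type) (a : R) : bounded_range (fun _ : T => a).
Proof. by exists `|a|. Qed.

Lemma bounded_indic (T : Type) (A : set T) : bounded_range (\1_A : T -> R).
Proof. by exists 1 => x; rewrite indicE; case: (x \in A); rewrite ?normr1 ?normr0. Qed.

Lemma bounded_add (T : Type) (f g : T -> R) : bounded_range f ->
  bounded_range g -> bounded_range (fun x => f x + g x).
Proof.
move=> [M fM] [M' gM']; exists (M + M') => x.
by rewrite (le_trans (ler_normD _ _))// lerD.
Qed.

Lemma bounded_mul (T : Type) (f g : T -> R) : bounded_range f ->
  bounded_range g -> bounded_range (fun x => f x * g x).
Proof.
move=> [M fM] [M' gM']; exists (M * M') => x.
by rewrite normrM ler_pM.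
Qed.

Lemma bounded_comp (T U : Type) (h : U -> T) (f : T -> R) : bounded_range f ->
  bounded_range (fun x => f (h x)).
Proof. by move=> [M fM]; exists M. Qed.

Lemma bounded_sum (T I : Type) (s : seq I) (f : I -> T -> R) :
  (forall i, bounded_range (f i)) -> bounded_range (fun x => \sum_(i <- s) f i x).
Proof.
move=> fb; elim: s => [|i s IH].
  by apply: (bounded_range_le (bounded_cst T 0)) => x; rewrite big_nil.
apply: (bounded_range_le (bounded_add (fb i) IH)) => x.
by rewrite big_cons.
Qed.

(** Segments are compact, so an ultrafilter assigns a limit to every bounded
function. *)
Lemma ultra_cvg (T : Type) (U : set_system T) (f : T -> R) :
  UltraFilter U -> bounded_range f -> cvg (f @ U).
Proof.
move=> UU [M fM].
have := @segment_compact R (- M) M; rewrite compact_ultra => cpt.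
have UfM : (f @ U) `[- M, M]%classic.
  by apply: nearW => x /=; rewrite in_itv/= -ler_norml.
have Uf : UltraFilter (f @ U).
  split; first exact: fmap_proper_filter.
  move=> G PG sUG; apply/seteqP; split=> // A GA.
  have [//|UnA] := in_ultra_setVsetC (f @^-1` A) UU.
  have GnA : G (~` A) by apply: sUG.
  have : G (A `&` ~` A) by exact: filterI.
  by rewrite setICr => /filter_not_empty.
by have [x [_ /= xl]] := cpt _ Uf UfM; apply/cvg_ex; exists x.
Qed.

(** Linearity and positivity are required on bounded functions only: the means
built below are ultrafilter limits, whose values on unbounded functions are
meaningless. *)
Record mean (T : Type) (m : (T -> R) -> R) : Prop := Mean {
  mean1 : m (fun=> 1) = 1 ;
  mean_lin : forall a f g, bounded_range f -> bounded_range g ->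
    m (fun x => a * f x + g x) = a * m f + m g ;
  mean_ge0 : forall f, bounded_range f -> (forall x, 0 <= f x) -> 0 <= m f }.

Section MeanTheory.
Context (T : Type) (m : (T -> R) -> R) (mm : mean m).

Lemma meanD f g : bounded_range f -> bounded_range g ->
  m (fun x => f x + g x) = m f + m g.
Proof.
move=> bf bg; rewrite -[m f]mul1r -(mean_lin mm)//; congr m.
by apply/funext => x; rewrite mul1r.
Qed.

Lemma mean0 : m (fun=> 0) = 0.
Proof.
have := meanD (bounded_cst T 0) (bounded_cst T 0).
by under eq_fun do rewrite addr0; lra.
Qed.

Lemma meanZ a f : bounded_range f -> m (fun x => a * f x) = a * m f.
Proof.
move=> bf; rewrite -[RHS]addr0 -mean0 -(mean_lin mm)//; last exact: bounded_cst.
by congr m; apply/funext => x; rewrite addr0.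
Qed.

Lemma mean_cst a : m (fun=> a) = a.
Proof.
by have := meanZ a (bounded_cst T 1); rewrite (mean1 mm) mulr1.
Qed.

Lemma meanB f g : bounded_range f -> bounded_range g ->
  m (fun x => f x - g x) = m f - m g.
Proof.
move=> bf bg; rewrite addrC -mulN1r -(mean_lin mm)//; congr m.
by apply/funext => x; rewrite mulN1r addrC.
Qed.

Lemma mean_le f g : bounded_range f -> bounded_range g ->
  (forall x, f x <= g x) -> m f <= m g.
Proof.
move=> bf bg fg; rewrite -subr_ge0 -meanB//; apply: mean_ge0 => //.
  rewrite (_ : (fun x => _) = fun x => g x + (-1) * f x); last first.
    by apply/funext => x; rewrite mulN1r.
  exact: bounded_add bg (bounded_mul (bounded_cst T (-1)) bf).
by move=> x; rewrite subr_ge0.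
Qed.

Lemma mean_sum (I : Type) (s : seq I) (f : I -> T -> R) :
  (forall i, bounded_range (f i)) ->
  m (fun x => \sum_(i <- s) f i x) = \sum_(i <- s) m (f i).
Proof.
move=> bf; elim: s => [|i s IH].
  by rewrite big_nil -[RHS]mean0; congr m; apply/funext => x; rewrite big_nil.
rewrite big_cons -IH -meanD//; last exact: bounded_sum.
by congr m; apply/funext => x; rewrite big_cons.
Qed.

(** The Cauchy-Schwarz inequality against the constant 1: the variance
m((f - m f)^2) is nonnegative. *)
Lemma mean_sqr_ge f : bounded_range f -> m f ^+ 2 <= m (fun x => f x ^+ 2).
Proof.
move=> bf; set a := m f.
have bf2 : bounded_range (fun x => f x ^+ 2) by exact: bounded_mul.
have ba : bounded_range (fun x => f x - a).
  exact: bounded_add bf (bounded_cst T (- a)).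
have : 0 <= m (fun x => (f x - a) * (f x - a)).
  by apply: (mean_ge0 mm) => [|x]; [exact: bounded_mul | rewrite -expr2 sqr_ge0].
rewrite (_ : (fun x => _) = fun x => (- (2 * a)) * f x + (f x ^+ 2 + a ^+ 2)).
  rewrite mean_lin//; last by apply: bounded_add => //; exact: bounded_cst.
  by rewrite meanD// ?mean_cst -/a; [nra | exact: bounded_cst].
by apply/funext => x; ring.
Qed.

Lemma mean_indic0 : m \1_set0 = 0.
Proof. by rewrite indic0; exact: mean0. Qed.

Lemma mean_indicT : m \1_setT = 1.
Proof. by rewrite indicT; exact: mean1. Qed.

End MeanTheory.
End Mean.

(** * Averages over finite sets and invariant means *)

Lemma filter_forall_seq (T : Type) (I : eqType) (F : set_system T)
    (s : seq I) (P : I -> set T) : Filter F ->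
  (forall i, i \in s -> F (P i)) -> F [set t | forall i, i \in s -> P i t].
Proof.
move=> FF; elim: s => [|i s IH] Ps; first exact: filterE.
have Pi := Ps i (mem_head _ _).
have {}IH := IH (fun j js => Ps j (mem_behead (s := i :: s) js)).
apply: filterS (filterI Pi IH) => t [Pit st] j.
by rewrite inE => /orP[/eqP ->//|]; exact: st.
Qed.

Section Averages.
Context {R : realType} {G : zmodType}.

Definition average (K : {fset G}) (f : G -> R) : R :=
  (\sum_(x <- K) f x) / #|` K|%:R.

Lemma card_fset_gt0 (K : {fset G}) : K != fset0 -> 0 < #|` K|%:R :> R.
Proof. by rewrite ltr0n cardfs_gt0. Qed.

Lemma average_lin K a f g :
  average K (fun x => a * f x + g x) = a * average K f + average K g.
Proof. by rewrite /average big_split/= -mulr_sumr mulrDl mulrA. Qed.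

Lemma average_le K f g : (forall x, x \in K -> f x <= g x) ->
  average K f <= average K g.
Proof.
move=> fg; rewrite ler_wpM2r ?invr_ge0 ?ler0n//.
by rewrite big_seq [leRHS]big_seq; exact: ler_sum.
Qed.

Lemma average_cst K a : K != fset0 -> average K (fun=> a) = a.
Proof.
move=> /card_fset_gt0 K0; rewrite /average big_const_seq count_predT iter_addr_0.
by rewrite -[a *+ _]mulr_natr mulfK// gt_eqF.
Qed.

Lemma average_ge0 K f : (forall x, 0 <= f x) -> 0 <= average K f.
Proof. by move=> f0; rewrite divr_ge0// sumr_ge0. Qed.

Lemma norm_sum_fset_le (K : {fset G}) (f : G -> R) M :
  (forall x, `|f x| <= M) -> `|\sum_(x <- K) f x| <= M * #|` K|%:R.
Proof.
move=> fM; apply: le_trans (ler_norm_sum _ _ _) _.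
rewrite mulr_natr -(iter_addr_0 (size _)) -count_predT -big_const_seq.
exact: ler_sum.
Qed.

Lemma norm_average_le K f M : (forall x, `|f x| <= M) -> `|average K f| <= M.
Proof.
move=> fM; have [->|K0] := eqVneq K fset0.
  by rewrite /average big_seq_fset0 mul0r normr0 (le_trans _ (fM 0)).
rewrite /average normrM normfV normr_nat ler_pdivrMr ?card_fset_gt0//.
exact: norm_sum_fset_le.
Qed.

Lemma norm_sum_symdiff_le (K L : {fset G}) (f : G -> R) M :
  (forall x, `|f x| <= M) ->
  `|\sum_(x <- K) f x - \sum_(x <- L) f x| <= M * #|` fsymdiff K L|%:R.
Proof.
move=> fM; rewrite (big_fsetID _ (fun x => x \in L)) /=.
rewrite [X in _ - X](big_fsetID _ (fun x => x \in K)) /=.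
rewrite (_ : [fset x in L | x \in K]%fset = [fset x in K | x \in L]%fset); last first.
  by apply/fsetP => x; rewrite !inE andbC.
rewrite opprD addrACA subrr add0r.
rewrite (_ : [fset x in K | x \notin L]%fset = (K `\` L)%fset); last first.
  by apply/fsetP => x; rewrite !inE andbC.
rewrite (_ : [fset x in L | x \notin K]%fset = (L `\` K)%fset); last first.
  by apply/fsetP => x; rewrite !inE andbC.
apply: le_trans (ler_normB _ _) _.
rewrite /fsymdiff.
have -> : #|` ((K `\` L) `|` (L `\` K))%fset| =
    (#|` (K `\` L)%fset| + #|` (L `\` K)%fset|)%N.
  rewrite -[RHS]cardfsUI (_ : (_ `&` _)%fset = fset0) ?cardfs0 ?addn0//.
  by apply/fsetP => x; rewrite !inE; case: (x \in K); case: (x \in L).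
by rewrite natrD mulrDr lerD// norm_sum_fset_le.
Qed.

Lemma average_shift_le K f M g : (forall x, `|f x| <= M) ->
  `|average K (fun x => f (g + x)) - average K f| <=
  M * (#|` fsymdiff (translate g K) K|%:R / #|` K|%:R).
Proof.
move=> fM; rewrite /average -mulrBl normrM normfV normr_nat mulrA.
rewrite ler_wpM2r ?invr_ge0 ?ler0n//.
rewrite (_ : \sum_(x <- K) f (g + x) = \sum_(x <- translate g K) f x).
  exact: norm_sum_symdiff_le.
by rewrite big_imfset//= => x y _ _; exact: addrI.
Qed.

Lemma folner_shift (F : nat -> {fset G}) f g :
  folner_sequence R F -> bounded_range f ->
  average (F N) (fun x => f (g + x)) - average (F N) f @[N --> \oo] --> 0.
Proof.
move=> [_ /(_ g) Fg] [M fM].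
have : M * (#|` fsymdiff (translate g (F N)) (F N)|%:R / #|` F N|%:R)
    @[N --> \oo] --> M * (0 : R) by apply: cvgM Fg; exact: cvg_cst.
rewrite mulr0 => MF; apply: norm_cvg0.
apply: (squeeze_cvgr _ (cvg_cst 0) MF); apply: nearW => N.
by rewrite normr_ge0 average_shift_le.
Qed.

Lemma folner_almost_invariant (F : nat -> {fset G}) (s : seq G) (e : R) :
  folner_sequence R F -> 0 < e -> \forall N \near \oo, forall g, g \in s ->
    #|` fsymdiff (translate g (F N)) (F N)|%:R / #|` F N|%:R <= e.
Proof.
move=> [_ FF] e0; apply: filter_forall_seq => g _.
have /cvgr0Pnorm_le /(_ e e0) := FF g.
by apply: filterS => N; apply: le_trans; exact: ler_norm.
Qed.

(** The nearly invariant finite sets in which A has density nearly d form a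
filter basis on the finite subsets of G: each requirement involves finitely many
translations and one tolerance e, so some late term of a single Folner sequence
meets it. The mean is the limit of averages along an ultrafilter refining that
basis. As the ultrafilter handles all e at once, m(1_A) reaches d itself, even
when d is a supremum over Folner sequences such as d*(A). *)
Lemma invariant_mean_exists (A : set G) (d : R) :
  (forall e, 0 < e -> exists2 F, folner_sequence R F &
     forall N0, exists2 N, (N0 <= N)%N & d - e <= average (F N) \1_A) ->
  exists m : (G -> R) -> R, [/\ mean m,
    (forall g f, bounded_range f -> m (fun x => f (g + x)) = m f) &
    d <= m \1_A].
Proof.
move=> dA.
pose ratio g (K : {fset G}) : R :=
  #|` fsymdiff (translate g K) K|%:R / #|` K|%:R.
pose D := [set p : seq G * R | 0 < p.2].
pose near_inv (p : seq G * R) := [set K : {fset G} | [/\ K != fset0,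
  forall g, g \in p.1 -> ratio g K <= p.2 & d - p.2 <= average K \1_A]].
have PF : ProperFilter (filter_from D near_inv).
  apply: filter_from_proper.
    apply: filter_from_filter; first by exists ([::], 1); rewrite /D /=; exact: ltr01.
    move=> [s e] [s' e']; rewrite /D /= => e0 e'0.
    exists (s ++ s', Num.min e e'); first by rewrite /= lt_min e0.
    move=> K [/= K0 Ks]; rewrite lerBlDr => KA.
    split; split => //=.
    - move=> g gs; have := Ks g; rewrite mem_cat gs => /(_ isT).
      by rewrite le_min => /andP[].
    - by rewrite lerBlDr (le_trans KA)// lerD2l ge_min lexx.
    - move=> g gs; have := Ks g; rewrite mem_cat gs orbT => /(_ isT).
      by rewrite le_min => /andP[].
    - by rewrite lerBlDr (le_trans KA)// lerD2l ge_min lexx orbT.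
  move=> [s e] /= e0; have [F hF Fd] := dA e e0.
  have [N0 _ FN0] := folner_almost_invariant s hF e0.
  have [N N0N dN] := Fd N0.
  by exists (F N); split => //=; [case: hF | exact: FN0].
have [U [UU sU]] := ultraFilterLemma PF.
pose m (f : G -> R) : R := lim (average K f @[K --> U]).
have cvm f : bounded_range f -> average K f @[K --> U] --> m f.
  move=> [M fM]; apply: ultra_cvg; exists M => K; exact: norm_average_le.
have near_e s e : 0 < e -> \forall K \near U, near_inv (s, e) K.
  by move=> e0; apply: sU; exists (s, e).
exists m; split; first split.
- apply: cvg_lim => //; apply: cvg_near_cst.
  by apply: filterS (near_e [::] 1 ltr01) => K [K0 _ _]; rewrite average_cst.
- move=> a f g bf bg; apply: cvg_lim => //.
  under eq_fun do rewrite average_lin.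
  by apply: cvgD (cvm _ bg); apply: cvgM (cvm _ bf); exact: cvg_cst.
- move=> f bf f0; apply: limr_ge; first by apply/cvg_ex; eexists; exact: cvm.
  by apply: nearW => K; exact: average_ge0.
- move=> g f bf; apply/eqP; rewrite -subr_eq0; apply/eqP.
  have bfg : bounded_range (fun x => f (g + x)) by exact: bounded_comp.
  have cvB : average K (fun x => f (g + x)) - average K f @[K --> U] -->
    m (fun x => f (g + x)) - m f by exact: cvgB (cvm _ bfg) (cvm _ bf).
  rewrite -(cvg_lim (@Rhausdorff R) cvB); apply: cvg_lim => //.
  have [M fM] := bf; have M0 : 0 <= M := le_trans (normr_ge0 _) (fM 0).
  apply/cvgr0Pnorm_le => e e0.
  have eM : 0 < e / (M + 1) by rewrite divr_gt0// ltr_wpDl.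
  apply: filterS (near_e [:: g] _ eM) => K [K0 /(_ g) + _].
  rewrite inE eqxx => /(_ isT) Kg; apply: le_trans (average_shift_le _ _ fM) _.
  apply: le_trans (ler_wpM2l M0 Kg) _.
  rewrite mulrCA ler_piMr ?(ltW e0)// ler_pdivrMr; lra.
- apply/ler_addgt0Pl => e e0; rewrite -lerBlDl; apply: limr_ge.
    by apply/cvg_ex; eexists; apply: cvm; exact: bounded_indic.
  by apply: filterS (near_e [::] e e0) => K [].
Qed.

End Averages.

(** * Correlations of a set along a Folner sequence *)

Section PositiveDefinite.
Context {R : realType} {G : zmodType}.

Lemma exists_le_average (K : {fset G}) (f : G -> R) : K != fset0 ->
  exists2 x, x \in K & f x <= average K f.
Proof.
move=> K0; apply: contrapT => /forall2NP Kf.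
have fK x : x \in K -> average K f < f x.
  by move=> xK; rewrite ltNge; apply/negP; case: (Kf x).
have /fset0Pn[x xK] := K0; have := lexx (average K f).
rewrite -{2}(average_cst (average K f) K0) leNgt => /negP; apply.
rewrite ltr_pM2r ?invr_gt0 ?card_fset_gt0// !(big_fsetD1 x xK)/=.
apply: ltr_leD; first exact: fK.
rewrite big_seq [leRHS]big_seq; apply: ler_sum => y.
by move=> /fsetD1P[_ /fK /ltW].
Qed.

(** Suppose that the average of psi over F_N is below k - e for infinitely many N.
By asymptotic invariance the average over b in F_N of psi (b - x) is then below
k - e / 2 simultaneously for all x in a given finite list s, so some b has
\sum_(x <- s) psi (b - x) <= size s * (k - e / 2). Adding such elements one at a
time gives lists of length n whose Gram sum is at most n + n (n - 1) (k - e / 2),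
which falls below the assumed bound n^2 k once n is large. *)
Lemma positive_definite_average (F : nat -> {fset G}) (psi : G -> R) (k e : R) :
  folner_sequence R F -> (forall g, `|psi g| <= 1) ->
  (forall g, psi (- g) = psi g) ->
  (forall s : seq G, (size s)%:R ^+ 2 * k <= \sum_(x <- s) \sum_(y <- s) psi (y - x)) ->
  0 < e -> \forall N \near \oo, k - e <= average (F N) psi.
Proof.
move=> hF psi1 psiN psi_pd e0.
apply: contrapT => nF.
have freq N0 : exists2 N, (N0 <= N)%N & average (F N) psi < k - e.
  apply: contrapT => /forall2NP lo; apply: nF; exists N0 => // N /= N0N.
  by rewrite leNgt; apply/negP; case: (lo N).
pose c := k - e / 2.
have next (s : seq G) : exists b, \sum_(x <- s) psi (b - x) <= (size s)%:R * c.
  have near_s : \forall N \near \oo, forall x, x \in s ->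
      `|average (F N) (fun b => psi (- x + b)) - average (F N) psi| <= e / 2.
    apply: filter_forall_seq => x _.
    have bpsi : bounded_range psi by exists 1.
    have /cvgr0Pnorm_le := folner_shift (- x) hF bpsi; apply.
    by rewrite divr_gt0.
  have [N0 _ N0s] := near_s; have [N N0N Nk] := freq N0.
  have [|b _ bN] := @exists_le_average (F N) (fun b => \sum_(x <- s) psi (b - x)).
    by case: hF.
  exists b; apply: le_trans bN _.
  rewrite /average exchange_big/= mulr_suml.
  have -> : (size s)%:R * c = \sum_(x <- s) c.
    by rewrite big_const_seq count_predT iter_addr_0 mulr_natl.
  rewrite big_seq [leRHS]big_seq; apply: ler_sum => x xs.
  have := N0s _ N0N x xs; rewrite ler_norml => /andP[_].
  rewrite /average; under eq_bigr do rewrite addrC.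
  rewrite -/(average _ psi) /c; lra.
have seqs n : exists2 s : seq G, size s = n &
    \sum_(x <- s) \sum_(y <- s) psi (y - x) <= n%:R + n%:R * (n%:R - 1) * c.
  elim: n => [|n [s sn IH]].
    by exists [::] => //; rewrite big_nil !mul0r addr0.
  have [b bs] := next s; exists (b :: s); first by rewrite /= sn.
  rewrite big_cons big_cons subrr.
  under [X in _ + X]eq_bigr do rewrite big_cons.
  rewrite big_split/=.
  have -> : \sum_(y <- s) psi (y - b) = \sum_(x <- s) psi (b - x).
    by apply: eq_bigr => y _; rewrite -psiN opprB.
  have p0 := le_trans (ler_norm _) (psi1 0).
  rewrite sn in bs; rewrite -natr1; nra.
pose n := Num.bound (`|2 * (1 - k) / e|).
have nk : 2 * (1 - k) / e < n%:R.
  by apply: le_lt_trans (ler_norm _) _; rewrite archi_boundP.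
rewrite ltr_pdivrMr// in nk.
have [s sn] := seqs n.+1; have := psi_pd s; rewrite sn => lo hi.
have := le_trans lo hi; rewrite -natr1 addrK expr2 -!mulrA.
have n1 : 0 < n%:R + 1 :> R by rewrite ltr_wpDl ?ler0n.
rewrite -[X in _ <= X + _]mulr1 -mulrDr ler_pM2l// /c; lra.
Qed.

End PositiveDefinite.

Section Correlation.
Context {R : realType} {G : zmodType} (m : (G -> R) -> R).
Hypotheses (mm : mean m)
  (mI : forall g f, bounded_range f -> m (fun x => f (g + x)) = m f).
Variable A : set G.

Let bA g : bounded_range (fun t : G => \1_A (g + t) : R).
Proof. exact: bounded_comp (bounded_indic A). Qed.

(** The positive definite function m(1_A . 1_(A - g)) of g. *)
Definition correlation (g : G) : R := m (fun t => \1_A t * \1_A (g + t)).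

Lemma mean_indic_mul x y :
  m (fun t => \1_A (x + t) * \1_A (y + t)) = correlation (y - x).
Proof.
rewrite /correlation -(mI x (bounded_mul (bounded_indic A) (bA (y - x)))).
by congr m; apply/funext => t; rewrite addrA subrK.
Qed.

Lemma correlationN g : correlation (- g) = correlation g.
Proof.
rewrite -[in LHS](sub0r g) -mean_indic_mul /correlation; congr m.
by apply/funext => t; rewrite add0r mulrC.
Qed.

Lemma norm_correlation_le1 g : `|correlation g| <= 1.
Proof.
have bg := bounded_mul (bounded_indic A) (bA g).
have b01 t : 0 <= (\1_A t * \1_A (g + t) : R) <= 1.
  by rewrite !indicE; case: (_ \in A); case: (_ \in A);
    rewrite ?mulr1 ?mulr0 ?lexx ler01.
rewrite ger0_norm; last by apply: (mean_ge0 mm) => // t; case/andP: (b01 t).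
rewrite -(mean1 mm); apply: (mean_le mm bg (bounded_cst G 1)) => t.
by case/andP: (b01 t).
Qed.

(** The Gram sum is the mean of the square of \sum_(x <- s) 1_(A - x), a function
whose mean is size s times that of 1_A. *)
Lemma sum_correlation_ge (s : seq G) :
  (size s)%:R ^+ 2 * m \1_A ^+ 2 <= \sum_(x <- s) \sum_(y <- s) correlation (y - x).
Proof.
have bs : bounded_range (fun t => \sum_(x <- s) \1_A (x + t) : R).
  exact: bounded_sum.
have -> : \sum_(x <- s) \sum_(y <- s) correlation (y - x) =
    m (fun t => (\sum_(x <- s) \1_A (x + t)) ^+ 2).
  have -> : (fun t => (\sum_(x <- s) \1_A (x + t)) ^+ 2) =
      fun t => \sum_(x <- s) \sum_(y <- s) \1_A (x + t) * \1_A (y + t) :> R.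
    by apply/funext => t; rewrite expr2 big_distrlr.
  rewrite (mean_sum mm); last first.
    by move=> x; apply: bounded_sum => y; exact: bounded_mul.
  apply: eq_bigr => x _; rewrite (mean_sum mm); last by move=> y; exact: bounded_mul.
  by apply: eq_bigr => y _; rewrite mean_indic_mul.
apply: le_trans (mean_sqr_ge mm bs).
rewrite (mean_sum mm)// (eq_bigr (fun=> m \1_A)); last first.
  by move=> x _; rewrite (mI x (bounded_indic A)).
by rewrite big_const_seq count_predT iter_addr_0 -[m _ *+ _]mulr_natl exprMn.
Qed.

End Correlation.

(** * A reverse Fatou lemma for finitely additive means *)

(** Shrinking a Q-set infinitely often produces a decreasing sequence of nonempty
sets, the n-th step of which lies in some L n N with n <= N; an ultrafilter
containing the whole sequence contains all these L n N. *)
Lemma ultrafilter_of_refinement (T : Type) (Q : set T -> Prop)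
    (L : nat -> nat -> set T) :
  ~ Q set0 -> (exists C, Q C) ->
  (forall C n, Q C -> exists N D, [/\ (n <= N)%N, D `<=` C, Q D & D `<=` L n N]) ->
  exists2 W : set_system T, UltraFilter W &
    forall n, exists2 N, (n <= N)%N & W (L n N).
Proof.
move=> Q0 [C0 QC0] step.
pose P (Cn : {C | Q C} * nat) (D : {C | Q C}) := sval D `<=` sval Cn.1 /\
  exists2 N, (Cn.2 <= N)%N & sval D `<=` L Cn.2 N.
have /choice[next nextP] : forall Cn, exists D, P Cn D.
  move=> [[C QC] n]; have [N [D [nN DC QD DL]]] := step C n QC.
  by exists (exist _ D QD); split=> //; exists N.
pose fix S n : {C | Q C} := if n is n'.+1 then next (S n', n') else exist _ C0 QC0.
have Smono a b : (a <= b)%N -> sval (S b) `<=` sval (S a).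
  move=> /subnK <-; elim: (b - a)%N => [//|d IH].
  by apply: subset_trans IH; exact: (nextP (S (d + a)%N, (d + a)%N)).1.
have PF : ProperFilter (filter_from setT (fun n => sval (S n))).
  apply: filter_from_proper.
    apply: filter_fromT_filter; first by exists 0%N.
    move=> i j; exists (maxn i j); rewrite subsetI.
    by split; apply: Smono; rewrite ?leq_maxl ?leq_maxr.
  move=> n _; apply/set0P/eqP => Sn; apply: Q0; rewrite -Sn.
  exact: svalP (S n).
have [W [UW sW]] := ultraFilterLemma PF.
exists W => // n; have [_ [N nN SL]] := nextP (S n, n).
by exists N => //; apply: sW; exists n.+1.
Qed.

Section ReverseFatou.
Context {R : realType} (T : Type) (m : (T -> R) -> R) (mm : mean m).
Variables (f : nat -> T -> R) (c : R).
Hypothesis f01 : forall N t, 0 <= f N t <= 1.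
Hypothesis fc : forall e, 0 < e -> \forall N \near \oo, c - e <= m (f N).

Let bI (C : set T) : bounded_range (\1_C : T -> R) := bounded_indic C.

Let bf N : bounded_range (f N).
Proof. by exists 1 => t; have /andP[f0 f1] := f01 N t; rewrite ger0_norm. Qed.

Let bIf C N : bounded_range (fun t => \1_C t * f N t : R).
Proof. exact: bounded_mul. Qed.

Let indic01 (C : set T) t : 0 <= (\1_C t : R) <= 1.
Proof. by rewrite indicE; case: (t \in C); rewrite ?lexx ler01. Qed.

Let mass (C : set T) : R := m \1_C.
Let weight C N : R := m (fun t => \1_C t * f N t).
Let level a N := [set t | a <= f N t].

Let mass_le1 C : mass C <= 1.
Proof.
rewrite -(mean1 mm); apply: (mean_le mm (bI C) (bounded_cst T 1)) => t.
by case/andP: (indic01 C t).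
Qed.

Let indic_split (C D : set T) : D `<=` C ->
  (\1_C : T -> R) = (fun t => \1_D t + \1_(C `\` D) t).
Proof.
move=> DC; apply/funext => t; rewrite !indicE in_setD.
have [tD|tD] := boolP (t \in D).
  by rewrite (mem_set (DC _ (set_mem tD))) addr0.
by rewrite andbT add0r.
Qed.

Let mass_split C D : D `<=` C -> mass C = mass D + mass (C `\` D).
Proof. by move=> DC; rewrite -meanD// -indic_split. Qed.

Let weight_split C D N : D `<=` C -> weight C N = weight D N + weight (C `\` D) N.
Proof.
move=> DC; rewrite -meanD//; congr m; apply/funext => t.
by rewrite (indic_split DC) mulrDl.
Qed.

(** Markov's inequality: on C, the function f N is at most a outside level a N, and
exceeds a by at most 1 + |a| on it. *)
Let weight_level a C N :
  weight C N <= a * mass C + (1 + `|a|) * mass (C `&` level a N).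
Proof.
rewrite /mass -[X in _ + X](meanZ mm)// -(mean_lin mm)//; last first.
  exact: bounded_mul (bounded_cst _ _) (bI _).
apply: mean_le => // [|t].
  by apply: bounded_add; apply: bounded_mul => //; exact: bounded_cst.
have /andP[f0 f1] := f01 N t.
rewrite !indicE in_setI; case: (t \in C); last by rewrite !mul0r !mulr0 addr0.
rewrite /= mul1r mulr1; have [/set_mem tl|/negP tl] := boolP (t \in level a N).
  by rewrite mulr1; have := ler_norm (- a); rewrite normrN; lra.
rewrite mulr0 addr0 ltW// ltNge; apply/negP => atl; apply: tl.
exact/mem_set.
Qed.

(** A finitely additive form of the reverse Fatou lemma. Take an ultrafilter V of
indices and compare the set functions nu C = lim_V m(1_C f_N) and c m(1_C)
through sigma = nu - c m, for which sigma(T) >= 0.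

If sigma(C) > 0 for some C, then C has a subset with sigma > 0 on which
f_N >= c for some large N, and the step can be repeated. Otherwise all subsets
of the sets C & {f_N >= c} have sigma <= 0, and so do those of their finite
unions; removing from C such a set E of nearly maximal mass leaves a set on which
every late f_N is below c up to small mass, so that sigma (C \ E) is small,
and sigma E <= 0, against sigma(C) > 0.

If sigma is never positive, additivity and sigma(T) >= 0 force sigma = 0. Then
every C of positive mass satisfies nu C = c m(1_C), so some late f_N is at least
c - 1 / (n + 1) on a subset of C of positive mass. Treating this case apart is
what yields the exact bound c instead of a loss fixed in advance. *)
Lemma ultrafilter_large_values :
  exists2 W : set_system T, UltraFilter W & forall e, 0 < e -> forall N0,
    exists2 N, (N0 <= N)%N & W [set t | c - e <= f N t].
Proof.
have [V [UV sV]] := ultraFilterLemma eventually_filter.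
pose nu C := lim (weight C N @[N --> V]).
have cvnu C : weight C N @[N --> V] --> nu C.
  apply: ultra_cvg; exists 1 => N; rewrite ger0_norm; last first.
    apply: (mean_ge0 mm) => // t.
    by have /andP[? _] := indic01 C t; have /andP[? _] := f01 N t; rewrite mulr_ge0.
  rewrite -(mean1 mm); apply: (mean_le mm (bIf C N) (bounded_cst T 1)) => t.
  have /andP[? ?] := indic01 C t; have /andP[? ?] := f01 N t.
  by rewrite mulr_ile1.
pose sigma C := nu C - c * mass C.
have sigmaD C D : D `<=` C -> sigma C = sigma D + sigma (C `\` D).
  move=> DC; rewrite /sigma (mass_split DC).
  suff -> : nu C = nu D + nu (C `\` D) by ring.
  apply: cvg_lim => //; under eq_fun do rewrite (weight_split _ DC).
  exact: cvgD.
have sigma0 : sigma set0 = 0.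
  by have := sigmaD set0 set0 (@subset_refl _ _); rewrite setDv; lra.
have sigmaT : 0 <= sigma setT.
  rewrite /sigma /mass indicT (mean1 mm) mulr1 subr_ge0.
  apply/ler_addgt0Pl => e e0; rewrite -lerBlDl; apply: limr_ge.
    by apply/cvg_ex; eexists; exact: cvnu.
  apply: filterS (sV _ (fc e0)) => N; congr (_ <= m _).
  by apply/funext => t; rewrite indicT mul1r.
suff [Q [Q0 QT step]] : exists Q : set T -> Prop, [/\ ~ Q set0, exists C, Q C &
    forall C n, Q C -> exists N D, [/\ (n <= N)%N, D `<=` C, Q D &
      D `<=` level (c - n.+1%:R^-1) N]].
  have [W UW LW] := ultrafilter_of_refinement Q0 QT step.
  exists W => // e e0 N0.
  pose n := maxn N0 (Num.bound e^-1).
  have [N nN WN] := LW n; exists N; first by apply: leq_trans nN; rewrite leq_maxl.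
  apply: filterS WN => t; apply: le_trans; rewrite lerD2l lerN2.
  rewrite invf_ple ?posrE//; apply: ltW.
  apply: lt_le_trans (archi_boundP _) _; first by rewrite invr_ge0 ltW.
  by rewrite ler_nat leqW// leq_maxr.
have [[C0 sC0]|s0] := pselect (exists C, 0 < sigma C).
- exists (fun C => 0 < sigma C); split; [by rewrite sigma0 ltxx|by exists C0|].
  move=> C n sC; apply: contrapT => noD.
  have sub_level N D : (n <= N)%N -> D `<=` C `&` level c N -> sigma D <= 0.
    move=> nN DCL; rewrite leNgt; apply/negP => sD; apply: noD.
    exists N, D; split=> // [t /DCL[]//|t /DCL[_]]; apply: le_trans.
    by rewrite gerBl invr_ge0.
  (* Asking for sigma <= 0 on all subsets of E makes this class closed under
     unions. *)
  pose null E := E `<=` C /\ forall D, D `<=` E -> sigma D <= 0.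
  have null_level N : (n <= N)%N -> null (C `&` level c N).
    by move=> nN; split=> [|D]; [exact: subIsetl|exact: sub_level].
  have nullU E E' : null E -> null E' -> null (E `|` E').
    move=> [EC nE] [EC' nE']; split=> [|D DEE]; first by rewrite subUset.
    rewrite (sigmaD D (D `&` E)); last exact: subIsetl.
    rewrite -oppr_ge0 opprD addr_ge0// oppr_ge0.
      by apply: nE; exact: subIsetr.
    apply: nE' => t [Dt]; rewrite not_andP => -[//|nEt].
    by case: (DEE t Dt).
  have sup_null : has_sup [set mass E | E in null].
    split; last by exists 1 => _ [E _ <-]; exact: mass_le1.
    exists (mass set0), set0 => //; split=> [|D]; first exact: sub0set.
    by rewrite subset0 => ->; rewrite sigma0.
  (* This makes the bound (1 + |c|) * eta of weight_level half of sigma C. *)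
  pose eta := sigma C / (2 * (1 + `|c|)).
  have c0 : 0 < 1 + `|c| by rewrite ltr_wpDr.
  have eta0 : 0 < eta by rewrite divr_gt0// mulr_gt0.
  have [_ [E nE <-] Eeta] := sup_adherent eta0 sup_null.
  have [EC sE] := nE.
  have small N : (n <= N)%N -> mass ((C `\` E) `&` level c N) <= eta.
    move=> nN; have := sup_ubound sup_null.2.
    move=> /(_ (mass (E `|` (C `&` level c N)))).
    have nU := nullU _ _ nE (null_level _ nN).
    move=> /(_ (ex_intro2 _ _ _ nU erefl)).
    rewrite (mass_split (@subsetUl _ E _)).
    have -> : (E `|` C `&` level c N) `\` E = (C `\` E) `&` level c N.
      by apply/seteqP; split=> t /=; tauto.
    lra.
  have nuCE : nu (C `\` E) <= c * mass (C `\` E) + (1 + `|c|) * eta.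
    apply: limr_le; first by apply/cvg_ex; eexists; exact: cvnu.
    apply: sV; exists n => // N /= nN; apply: le_trans (weight_level c _ _) _.
    by rewrite lerD2l ler_pM2l// small.
  have sCE : sigma (C `\` E) <= sigma C / 2.
    rewrite /sigma lerBlDl; apply: le_trans nuCE _; rewrite lerD2l.
    rewrite (_ : _ * eta = sigma C / 2)// /eta; field.
    by rewrite gt_eqF.
  by have := sigmaD _ _ EC; have := sE _ (@subset_refl _ E); lra.
- have s_eq0 C : sigma C = 0.
    have s_le0 D : sigma D <= 0 by rewrite leNgt; apply/negP => ?; apply: s0; exists D.
    have := sigmaD _ _ (@subsetT _ C).
    by have := s_le0 C; have := s_le0 (setT `\` C); lra.
  exists (fun C => 0 < mass C); split.
  + by rewrite /mass (mean_indic0 mm) ltxx.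
  + by exists setT; rewrite /mass (mean_indicT mm).
  move=> C n C0; set a := c - _.
  have anu : a * mass C < nu C.
    have := s_eq0 C; rewrite /sigma => /eqP; rewrite subr_eq0 => /eqP ->.
    by rewrite ltr_pM2r// /a ltrBlDr ltrDl invr_gt0.
  have nearN : \forall N \near V, a * mass C < weight C N.
    by apply: (cvgr_gt (nu C)) => //; exact: cvnu.
  have nearn : \forall N \near V, (n <= N)%N by apply: sV; exists n.
  have [N [aN nN]] := filter_ex (filterI nearN nearn).
  exists N, (C `&` level a N); split => //; try exact: subIsetr.
  have := lt_le_trans aN (weight_level a C N).
  by rewrite ltrDl pmulr_rgt0.
Qed.

End ReverseFatou.

(** * Densities and the theorem *)

Section Density.
Context {R : realType}.

Lemma le_limn_esup (u : nat -> R) (c : R) :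
  (forall e, 0 < e -> forall N0, exists2 N, (N0 <= N)%N & c - e <= u N) ->
  (c%:E <= limn_esup (fun N => (u N)%:E))%E.
Proof.
move=> uc; apply: le_ereal_inf_tmp => _ [V [N0 _ VN0] <-].
apply/lee_addgt0Pr => e e0; have [N N0N cu] := uc e e0 N0.
apply: (@le_trans _ _ (u N + e)%:E); first by rewrite lee_fin -lerBlDr.
rewrite EFinD leeD2r//; apply: ereal_sup_ubound.
by exists N => //; exact: VN0.
Qed.

Lemma limn_esup_frequently (u : nat -> R) (c : R) :
  (c%:E < limn_esup (fun N => (u N)%:E))%E ->
  forall N0, exists2 N, (N0 <= N)%N & c <= u N.
Proof.
move=> cu N0; apply: contrapT => /forall2NP lo; move: cu; apply/negP.
rewrite -leNgt; apply: (@le_trans _ _ (ereal_sup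
    ((fun N => (u N)%:E) @` [set N | (N0 <= N)%N]))).
  apply: ereal_inf_lbound; exists [set N | (N0 <= N)%N] => //.
  by exists N0.
apply: ge_ereal_sup => _ [N /= N0N <-]; rewrite lee_fin leNgt.
by apply/negP => /ltW cN; case: (lo N).
Qed.

Context {G : zmodType}.

Lemma average_indic (K : {fset G}) (E : set G) :
  #|` [fset x in K | x \in E]%fset|%:R / #|` K|%:R = average K (\1_E : G -> R).
Proof.
congr (_ / _); under [RHS]eq_bigr do rewrite indicE.
rewrite card_fset_sum1 natr_sum big_fset/= big_mkcond/=.
by apply: eq_bigr => x _; case: (x \in E).
Qed.

Lemma upper_densityE F (E : set G) :
  upper_density R F E = limn_esup (fun N => (average (F N) \1_E : R)%:E).
Proof. by congr limn_esup; apply/funext => N; rewrite average_indic. Qed.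

Lemma upper_density_ge0 F (E : set G) : (0 <= upper_density R F E)%E.
Proof.
rewrite upper_densityE; apply: le_limn_esup => e e0 N; exists N => //.
apply: (@le_trans _ _ 0); first by rewrite sub0r oppr_le0 ltW.
by apply: average_ge0 => x; rewrite indicE ler0n.
Qed.

Lemma upper_density_le1 F (E : set G) : (upper_density R F E <= 1)%E.
Proof.
rewrite upper_densityE; apply: (@le_trans _ _ (ereal_sup
    ((fun N => (average (F N) \1_E : R)%:E) @` setT))).
  by apply: ereal_inf_lbound; exists setT => //; exists 0%N.
apply: ge_ereal_sup => _ [N _ <-]; rewrite lee_fin.
apply: le_trans (ler_norm _) _; apply: norm_average_le => x.
by rewrite indicE; case: (x \in E); rewrite ?normr1 ?normr0.
Qed.

Lemma upper_banach_density_fin (F : nat -> {fset G}) (E : set G) : folner_sequence R F ->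
  exists2 d : R, 0 <= d & upper_banach_density R E = d%:E.
Proof.
move=> hF.
have ge0 : (0 <= upper_banach_density R E)%E.
  apply: le_trans (upper_density_ge0 F E) _.
  by apply: ereal_sup_ubound; exists F.
have le1 : (upper_banach_density R E <= 1)%E.
  by apply: ge_ereal_sup => _ [F' _ <-]; exact: upper_density_le1.
case: (upper_banach_density R E) ge0 le1 => [d d0 _||] //.
by exists d.
Qed.

End Density.

Section AverageOfSections.
Context {R : realType} {G : zmodType}.

Lemma mean_average (T : Type) (m : (T -> R) -> R) (K : {fset G})
    (f : T -> G -> R) : mean m -> (forall b, bounded_range (f ^~ b)) ->
  m (fun t => average K (f t)) = average K (fun b => m (f ^~ b)).
Proof.
move=> mm bf; rewrite /average -mean_sum// mulrC -meanZ//; last exact: bounded_sum.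
by congr m; apply/funext => t; rewrite mulrC.
Qed.

(** W contains S b or its complement for each b, and finitely many members of W
meet in a member of W. *)
Lemma ultrafilter_decides (T : Type) (W : set_system T) (K : {fset G})
    (S : G -> set T) : UltraFilter W ->
  W [set t | forall b, b \in K -> (b \in [set b | W (S b)]) = (t \in S b)].
Proof.
move=> UW; apply: filter_forall_seq => b _.
have [WS|WnS] := in_ultra_setVsetC (S b) UW.
  by apply: (filterS _ WS) => t St; rewrite (mem_set St) mem_set.
apply: (filterS _ WnS) => t nSt; rewrite (memNset nSt) memNset//= => WS.
by apply: (@filter_not_empty _ W); rewrite -(setICr (S b)); exact: filterI.
Qed.

End AverageOfSections.

Theorem theorem1p25 (R : realType) (G : zmodType)
    (hG : ([set: G] #= [set: nat])%card) (A : set G)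
    (F : nat -> {fset G}) (hF : folner_sequence R F) :
  exists B : set G,
    (upper_banach_density R A ^+ 2 <= upper_density R F B)%E /\
    sumset B B `<=` diffset A A.
Proof.
have [d d0 dA] := upper_banach_density_fin A hF.
have [m [mm mI dm]] : exists m : (G -> R) -> R, [/\ mean m,
    (forall g f, bounded_range f -> m (fun x => f (g + x)) = m f) &
    d <= m \1_A].
  apply: invariant_mean_exists => e e0.
  have : ((d - e)%:E < upper_banach_density R A)%E.
    by rewrite dA lte_fin ltrBlDr ltrDl.
  move=> /ereal_sup_gt[_ [F' hF' <-]]; rewrite upper_densityE => /limn_esup_frequently.
  by exists F'.
(* Bt b is the set of t with b in B(t). *)
pose Bt (b : G) := [set t : G | A (b + t) /\ A (- b + t)].
pose f N t : R := average (F N) (fun b => \1_(Bt b) t).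
have indicBt b t : \1_(Bt b) t = \1_A (- b + t) * \1_A (b + t) :> R.
  rewrite !indicE -natrM mulnb; congr (nat_of_bool _)%:R.
  apply/idP/andP => [/set_mem[? ?]|[/set_mem ? /set_mem ?]]; last exact: mem_set.
  by split; exact: mem_set.
have f01 N t : 0 <= f N t <= 1.
  apply/andP; split; first by apply: average_ge0 => b; rewrite indicE ler0n.
  apply: le_trans (ler_norm _) _; apply: norm_average_le => b.
  by rewrite indicE; case: (_ \in _); rewrite ?normr1 ?normr0.
have mf N : m (f N) = average (F N) (fun b => correlation m A (b + b)).
  rewrite (mean_average _ mm); last by move=> b; exact: bounded_indic.
  congr average; apply/funext => b.
  have -> : b + b = b - - b by rewrite opprK.
  rewrite -(mean_indic_mul mI); congr m; apply/funext => t; exact: indicBt.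
have fc e : 0 < e -> \forall N \near \oo, m \1_A ^+ 2 - e <= m (f N).
  move=> e0; under eq_near do rewrite mf.
  apply: positive_definite_average => // [g|g|s].
  - exact: norm_correlation_le1.
  - by rewrite -opprD correlationN.
  (* Doubling is a homomorphism, so it preserves the Gram sums' lower bound. *)
  have := sum_correlation_ge mm mI A [seq x + x | x <- s].
  rewrite size_map big_map; congr (_ <= _); apply: eq_bigr => x _.
  by rewrite big_map; apply: eq_bigr => y _; rewrite opprD addrACA.
have [W UW Wf] := ultrafilter_large_values mm f01 fc.
exists [set b | W (Bt b)]; split.
  apply: (@le_trans _ _ ((m \1_A) ^+ 2)%:E).
    by rewrite dA -EFin_expe lee_fin lerXn2r ?nnegrE// (le_trans d0).
  rewrite upper_densityE; apply: le_limn_esup => e e0 N0.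
  have [N N0N WN] := Wf e e0 N0; exists N => //.
  have [t [/= ft Bft]] := filter_ex (filterI WN (ultrafilter_decides (F N) Bt UW)).
  apply: le_trans ft _; apply: average_le => b bF.
  by rewrite !indicE Bft.
move=> _ [b Wb [b' Wb'] <-].
have [t [[Abt _] [_ Ab't]]] := filter_ex (filterI Wb Wb').
exists (b + t) => //; exists (- b' + t) => //.
by rewrite opprD opprK addrACA subrr addr0.
Qed.
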